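(* Let $n$ and $m$ be positive integers and let $\xi_n \in \mathbb{C}$ be a primitive $n$-th root of unity. Let $a_1,\dots,a_m,b_1,\dots,b_m\in\mathbb{C}$ with no $nb_i$ a negative integer or zero, and let $z\in\mathbb{C}$ be such that all series on the left-hand side below converge. Then $$\sum_{l=0}^{n-1} {}_mF_{m}\left[ \begin{array}{cccc} n a_1, & n a_2, & \dots, & n a_m \\ n b_1, & n b_2, & \dots, & n b_m \end{array} \Big| \; \xi_n^l z \right] = n \cdot {}_{nm}F_{nm}\left[ \begin{array}{c} a_i+\frac{l}{n} : 1 \leq i \leq m,\ 0 \leq l \leq n-1 \\ b_i +\frac{l}{n} : 1 \leq i \leq m,\ 0 \leq l \leq n-1 \end{array} \Big| \; z^n \right].$$
   Context: The classical generalized hypergeometric series is, with the convention used here, $${}_mF_{m}\left[ \begin{array}{cccc} a_1, & a_2, & \dots, & a_m \\ b_1, & b_2, & \dots, & b_m \end{array} \Big| \; z \right] :=\sum_{k=0}^{\infty} \frac{(a_1)_k (a_2)_k \cdots (a_m)_k}{(b_1)_k (b_2)_k \cdots (b_m)_k}\, z^k,$$ where $a_i,b_i,z\in\mathbb{C}$, no $b_i$ is a negative integer or zero, $(a)_0:=1$ and $(a)_k:=a(a+1)\cdots(a+k-1)$ for $k\ge1$. (There is no additional $k!$ in the denominator; taking $b_1=1$ recovers the usual ${}_mF_{m-1}$.) *)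

(* Defs.v *)
From mathcomp Require Import all_boot all_order all_algebra.
From mathcomp Require Import all_classical all_reals all_analysis.
From mathcomp Require Export complex.
Import GRing.Theory Num.Theory.
Import numFieldNormedType.Exports.

Set Implicit Arguments.
Unset Strict Implicit.
Unset Printing Implicit Defensive.

Local Open Scope ring_scope.
Local Open Scope classical_set_scope.

(* The definitions are over an arbitrary numFieldType, because R[i] (the
   complex numbers over R) gets its norm topology from its numFieldType
   structure. *)

Definition pochhammer (K : numFieldType) (a : K) (k : nat) : K :=
  \prod_(j < k) (a + j%:R).

(* The numbers of upper and lower parameters are both #|I|. There is no k! in
   the denominator: the usual series with one lower parameter fewer is the case
   where one of the b i is 1. *)
Definition hypergeo_term (K : numFieldType) (I : finType) (a b : I -> K)
    (z : K) (k : nat) : K :=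
  (\prod_(i : I) pochhammer (a i) k) / (\prod_(i : I) pochhammer (b i) k)
  * z ^+ k.

Definition hypergeo_cvg (K : numFieldType) (I : finType) (a b : I -> K)
    (z : K) : Prop :=
  cvgn (series (hypergeo_term a b z)).

(* As a limit, this is meaningful only under hypergeo_cvg a b z. *)
Definition hypergeo (K : numFieldType) (I : finType) (a b : I -> K)
    (z : K) : K :=
  limn (series (hypergeo_term a b z)).

(* Main.v *)
(* Summing over the n-th roots of unity keeps only the terms of index j n, each
   multiplied by n. Splitting (n x)_(j n) by residues mod n gives
   (n x)_(j n) = n^(j n) \prod_(l < n) (x + l/n)_j, and the powers of n cancel in
   the quotient, since there are as many upper as lower parameters. So n times
   the N-th partial sum on the right is the sum of the (N n)-th partial sums on
   the left. *)
Require Import Defs.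
From mathcomp Require Import all_boot all_order all_algebra.
From mathcomp Require Import all_classical all_reals all_analysis.
From mathcomp Require Import complex.
Import GRing.Theory Num.Theory.

Local Open Scope ring_scope.
Local Open Scope complex_scope.

Import numFieldNormedType.Exports.

Lemma pochhammerD (K : numFieldType) (x : K) (k n : nat) :
  pochhammer x (k + n) = pochhammer x k * \prod_(l < n) (x + k%:R + l%:R).
Proof.
rewrite /pochhammer big_split_ord /=; congr (_ * _).
by apply: eq_bigr => l _; rewrite natrD addrA.
Qed.

(** Induction on [j]: passing from [j] to [j + 1] appends the [n] consecutive factors n x + j n + l
    with l < n, and each of them equals n (x + l/n + j). *)
Lemma pochhammer_mulnr (K : numFieldType) (x : K) (n j : nat) : (0 < n)%N ->
  pochhammer (n%:R * x) (j * n) =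
  n%:R ^+ (j * n) * \prod_(l < n) pochhammer (x + l%:R / n%:R) j.
Proof.
move=> n_gt0; have n_neq0 : n%:R != 0 :> K by rewrite pnatr_eq0 -lt0n.
elim: j => [|j IHj].
  rewrite mul0n /pochhammer big_ord0 expr0 mul1r.
  by rewrite big1 // => l _; rewrite big_ord0.
have -> : \prod_(l < n) pochhammer (x + l%:R / n%:R) j.+1 =
    \prod_(l < n) pochhammer (x + l%:R / n%:R) j *
    \prod_(l < n) (x + l%:R / n%:R + j%:R).
  by rewrite -big_split; apply: eq_bigr => l _; rewrite /pochhammer big_ord_recr.
rewrite mulSnr pochhammerD IHj exprD -!mulrA; congr (_ * _).
rewrite [RHS]mulrCA; congr (_ * _).
have -> : n%:R ^+ n = \prod_(l < n) n%:R :> K by rewrite prodr_const card_ord.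
rewrite -big_split.
apply: eq_bigr => l _ /=.
by rewrite natrM !mulrDr mulrCA divff // mulr1 addrAC (mulrC j%:R).
Qed.

Lemma hypergeo_term_mulnr (K : numFieldType) (n : nat) (I : finType)
    (a b : I -> K) (z : K) (j : nat) : (0 < n)%N ->
  hypergeo_term (fun i => n%:R * a i) (fun i => n%:R * b i) z (j * n) =
  hypergeo_term (fun p : I * 'I_n => a p.1 + p.2%:R / n%:R)
    (fun p : I * 'I_n => b p.1 + p.2%:R / n%:R) (z ^+ n) j.
Proof.
move=> n_gt0; have n_neq0 : n%:R != 0 :> K by rewrite pnatr_eq0 -lt0n.
have prodE (c : I -> K) : \prod_i pochhammer (n%:R * c i) (j * n) =
    (n%:R ^+ (j * n)) ^+ #|I| *
    \prod_(p : I * 'I_n) pochhammer (c p.1 + p.2%:R / n%:R) j.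
  under eq_bigr do rewrite pochhammer_mulnr //.
  by rewrite big_split prodr_const /= pair_bigA.
(* Numerator and denominator carry the same nonzero factor [(n%:R ^+ (j * n)) ^+ #|I|]. *)
rewrite /hypergeo_term !prodE -(exprM z) (mulnC n j) -mulf_div divff ?mul1r //.
by rewrite !expf_neq0.
Qed.

Lemma hypergeo_termZ (K : numFieldType) (I : finType) (a b : I -> K)
    (w z : K) (k : nat) :
  hypergeo_term a b (w * z) k = w ^+ k * hypergeo_term a b z k.
Proof. by rewrite /hypergeo_term exprMn mulrCA. Qed.

(** A geometric sum of ratio [xi ^+ k]. If the ratio is 1, every term is 1; otherwise multiplying by
    the nonzero [xi ^+ k - 1] telescopes the sum to [(xi ^+ k) ^+ n - 1], which is 0. *)
Lemma sum_primitive_root (K : fieldType) (n : nat) (xi : K) (k : nat) :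
  n.-primitive_root xi ->
  \sum_(l < n) (xi ^+ l) ^+ k = if (n %| k)%N then n%:R else 0.
Proof.
move=> xi_prim; under eq_bigr do rewrite -exprM mulnC exprM.
rewrite (prim_order_dvd xi_prim).
case: eqVneq => [->|xik_neq1].
  by under eq_bigr do rewrite expr1n; rewrite sumr_const card_ord.
apply: (mulfI (x := xi ^+ k - 1)); first by rewrite subr_eq0.
by rewrite -subrX1 mulr0 exprAC (prim_expr_order xi_prim) expr1n subrr.
Qed.

Lemma sum_hypergeo_term_root (K : numFieldType) (n : nat) (xi : K)
    (I : finType) (a b : I -> K) (z : K) (k : nat) :
  n.-primitive_root xi ->
  \sum_(l < n) hypergeo_term a b (xi ^+ l * z) k =
  if (n %| k)%N then n%:R * hypergeo_term a b z k else 0.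
Proof.
move=> xi_prim; under eq_bigr do rewrite hypergeo_termZ.
by rewrite -mulr_suml sum_primitive_root //; case: ifP; rewrite ?mul0r.
Qed.

(** Cutting at [N * n] leaves [N] full blocks of [n] consecutive indices, each containing exactly
    one multiple of [n], namely its first element. *)
Lemma sum_series_hypergeo_root (K : numFieldType) (n : nat) (xi : K)
    (I : finType) (a b : I -> K) (z : K) (N : nat) :
  n.-primitive_root xi ->
  \sum_(l < n) series (hypergeo_term a b (xi ^+ l * z)) (N * n)%N =
  n%:R * \sum_(0 <= j < N) hypergeo_term a b z (j * n).
Proof.
move=> xi_prim; rewrite /series /= exchange_big /=.
under eq_bigr do rewrite sum_hypergeo_term_root //.
have n_gt0 := prim_order_gt0 xi_prim.
elim: N => [|N IHN]; first by rewrite mul0n !big_geq // mulr0.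
rewrite big_nat_recr //= mulrDr -IHN mulSnr.
rewrite (big_cat_nat (n := (N * n)%N)) ?leq_addr //=; congr (_ + _).
rewrite big_ltn ?dvdn_mull //; last by rewrite -[ltnLHS]addn0 ltn_add2l.
(* A further multiple q n in the block would satisfy N n < q n < (N + 1) n, hence N < q <= N. *)
rewrite big_nat_cond big1 ?addr0 // => k /andP[/andP[lt_Nn_k lt_k] _].
case: ifP => // /dvdnP[q k_eq]; move: lt_Nn_k lt_k.
by rewrite k_eq -mulSnr !ltn_pmul2r // ltnS => /leq_trans/[apply]; rewrite ltnn.
Qed.

Theorem theorem2p12 (R : realType) (n m : nat) (xi : R[i])
    (a b : 'I_m -> R[i]) (z : R[i]) :
  (0 < n)%N -> (0 < m)%N ->
  n.-primitive_root xi ->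
  (forall (i : 'I_m) (k : nat), n%:R * b i <> - k%:R) ->
  (forall l : 'I_n,
     hypergeo_cvg (fun i : 'I_m => n%:R * a i) (fun i : 'I_m => n%:R * b i)
       (xi ^+ l * z)) ->
  hypergeo_cvg (fun p : 'I_m * 'I_n => a p.1 + p.2%:R / n%:R)
    (fun p : 'I_m * 'I_n => b p.1 + p.2%:R / n%:R) (z ^+ n) /\
  \sum_(l < n)
     hypergeo (fun i : 'I_m => n%:R * a i) (fun i : 'I_m => n%:R * b i)
       (xi ^+ l * z)
  = n%:R * hypergeo (fun p : 'I_m * 'I_n => a p.1 + p.2%:R / n%:R)
             (fun p : 'I_m * 'I_n => b p.1 + p.2%:R / n%:R) (z ^+ n).
Proof.
move=> n_gt0 _ xi_prim _ cvg_l.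
set a' := fun p : 'I_m * 'I_n => a p.1 + _.
set b' := fun p : 'I_m * 'I_n => b p.1 + _.
set S := \sum_(l < n) _.
have n_neq0 : n%:R != 0 :> R[i] by rewrite pnatr_eq0 -lt0n.
(* Naming the limit gives both conclusions at once: convergence on the right and its value. *)
have cvgS : (series (hypergeo_term a' b' (z ^+ n)) @ \oo -->
  n%:R^-1 * S)%classic.
  have -> : series (hypergeo_term a' b' (z ^+ n)) = fun N => n%:R^-1 *
      \sum_(l < n) series (hypergeo_term (fun i => n%:R * a i)
        (fun i => n%:R * b i) (xi ^+ l * z)) (N * n)%N.
    apply/funext => N; rewrite sum_series_hypergeo_root // mulKf //.
    by apply: eq_bigr => j _; rewrite hypergeo_term_mulnr.
  apply: cvgM; first exact: cvg_cst.
  apply: cvg_big => [|l _]; first exact: add_continuous.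
  (* The partial sums at [N * n] form a subsequence of a convergent sequence, since [n] is
     positive. *)
  apply: (cvg_comp (fun N => (N * n)%N)); last exact: cvg_l.
  exact: cvg_mulnr.
by split; [exact: cvgP cvgS | rewrite /hypergeo (cvg_lim _ cvgS) // mulVKf].
Qed.
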